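(* Let $(X,d)$ be a finite dimensional metric space with Borel $\sigma$-algebra $\mathcal{A}$, and let $(X,\mathcal{A},\mu,T)$ be a measure preserving system such that $\underline{C}_\mu>0$. Then for $\mu\otimes\mu$-almost every $(x,y)\in X\times X$, $$\limsup_{n\to+\infty}\frac{\log m_n(x,y)}{-\log n}\leq\frac{2}{\underline{C}_\mu}.$$
   Context: A measure preserving system $(X,\mathcal{A},\mu,T)$ consists of a measurable map $T:X\to X$ and a probability measure $\mu$ on $(X,\mathcal{A})$ that is $T$-invariant: $\mu(T^{-1}A)=\mu(A)$ for all $A\in\mathcal{A}$. $B(x,r)$ denotes the open ball of center $x$ and radius $r$. The shortest distance between the orbits of $x$ and $y$ up to time $n$ is $$m_n(x,y)=\min_{i,j=0,\dots,n-1} d(T^ix,T^jy).$$ Convention: $\log 0=-\infty$, so that $\frac{\log m_n(x,y)}{-\log n}=+\infty$ if $m_n(x,y)=0$ (and $n\ge 2$). The lower correlation dimension of $\mu$ is $$\underline{C}_\mu=\liminf_{r\to0}\frac{\log\int_X\mu(B(x,r))\,d\mu(x)}{\log r}.$$ *)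

(* Defs.v *)
From HB Require Import structures.
From mathcomp Require Import all_boot all_order all_algebra.
From mathcomp Require Import all_classical all_reals all_analysis.

Set Implicit Arguments.
Unset Strict Implicit.
Unset Printing Implicit Defensive.

Import Order.TTheory GRing.Theory Num.Theory.
Import numFieldNormedType.Exports.

Local Open Scope classical_set_scope.
Local Open Scope ring_scope.

(* The metric and the sigma-algebra are unrelated here; they are tied together
   by [borel_measurable]. *)
#[short(type="metricMeasurableType")]
HB.structure Definition MetricMeasurable (R : numDomainType)
    (d : measure_display) := {T of Metric R T & Measurable d T}.

Definition borel_measurable (R : realType) (d : measure_display)
    (X : metricMeasurableType R d) : Prop :=
  (measurable : set (set X)) = <<s (open : set (set X)) >>.

Definition measure_preserving (R : realType) (d : measure_display)
    (X : measurableType d) (mu : probability X R) (T : X -> X) : Prop :=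
  measurable_fun [set: X] T /\
  forall A : set X, measurable A -> mu (T @^-1` A) = mu A.

Section hausdorff_dimension.
Context {R : realType} {X : metricType R}.
Local Open Scope ereal_scope.

(* The maximum with 0 only serves to give the empty set diameter 0. *)
Definition diameter (A : set X) : \bar R :=
  maxe 0 (ereal_sup [set (mdist z.1 z.2)%:E | z in A `*` A]).

Definition hausdorff_premeasure (s delta : R) (A : set X) : \bar R :=
  ereal_inf [set \sum_(0 <= i <oo) poweR (diameter (U i)) s |
    U in [set U : (set X)^nat |
      A `<=` \bigcup_i U i /\ forall i, diameter (U i) <= delta%:E]].

Definition hausdorff_measure (s : R) (A : set X) : \bar R :=
  ereal_sup [set hausdorff_premeasure s delta A |
    delta in [set delta : R | (0 < delta)%R]].

(* Restricting to s > 0 does not change the infimum and avoids fixing a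
   convention for the 0th power of a zero diameter. If no s qualifies, the
   infimum is +oo. *)
Definition hausdorff_dim (A : set X) : \bar R :=
  ereal_inf [set s%:E | s in
    [set s : R | (0 < s)%R /\ hausdorff_measure s A = 0]].

(* Finite dimension is understood as finite Hausdorff dimension. It is implied
   by finiteness of the packing, box-counting or Assouad dimension, and it
   forces X to be separable. *)
Definition finite_dimensional : Prop := hausdorff_dim [set: X] < +oo.

End hausdorff_dimension.
Arguments finite_dimensional {R} X.

(* The iterated minimum starts from mdist x y, which for 1 <= n is the term
   i = j = 0 of the family. *)
Definition orbit_dist (R : realType) (X : metricType R) (T : X -> X)
    (n : nat) (x y : X) : R :=
  \big[Num.min/mdist x y]_(i < n) \big[Num.min/mdist x y]_(j < n)
    mdist (iter i T x) (iter j T y).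

(* [lne 0 = -oo] and -oo divided by a negative real is +oo in \bar R. *)
Definition lower_correlation_dim (R : realType) (d : measure_display)
    (X : metricMeasurableType R d) (mu : probability X R) : \bar R :=
  limf_einf
    (fun r : R => lne (\int[mu]_x mu (ball x r)) / (ln r)%:E)%E (0^'+).

(* Main.v *)
Require Import Defs.
From HB Require Import structures.
From mathcomp Require Import all_boot all_order all_algebra.
From mathcomp Require Import all_classical all_reals all_analysis.
From mathcomp Require Import ring lra.

Set Implicit Arguments.
Unset Strict Implicit.
Unset Printing Implicit Defensive.

Import Order.TTheory GRing.Theory Num.Theory.
Import numFieldNormedType.Exports.

Local Open Scope classical_set_scope.
Local Open Scope ring_scope.

(** The proof is a first-moment estimate followed by a Borel-Cantelli argument.

    Write I(r) for the integral of mu (B(x, r)), which is the mass that the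
    product measure gives to the pairs at distance less than r. For fixed i
    and j the map (x, y) |-> (T^i x, T^j y) preserves the product measure, so
    the pairs with d(T^i x, T^j y) < r also have mass I(r); a union bound over
    i, j < n gives the set where m_n < r a mass of at most n^2 I(r)
    ([close_orbits_measure_le]).

    Let c be smaller than the lower correlation dimension. Then I(r) <= r^c for
    small r ([close_pairs_measure_le]). Take s with c s > 2. Along n = 2^k and
    r = 2^(- s k) the bound n^2 I(r) <= 2^(k (2 - c s)) is summable, so for
    almost every pair m_(2^k) >= 2^(- s k) for all large k
    ([ae_limn_esup_orbit_dist_le]). As m_n decreases with n, the powers of two
    control all n: if 2^k <= n < 2^(k+1), then - log m_n <= s (k+1) log 2, while
    log n >= k log 2, and the limsup is at most s
    ([limn_esup_orbit_dist_le]). Letting s decrease to 2 / C along a sequence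
    gives the theorem.

    Finite dimension enters only to make the distance function measurable for
    the product sigma-algebra, which can fail for nonseparable X: finite
    Hausdorff dimension yields countable covers by sets of arbitrarily small
    diameter, hence separability ([finite_dimensional_separable]), and then
    the set of pairs at distance less than r is a countable union of products
    of balls ([measurable_close_pairs]). *)

(** * Separability and measurability of the distance *)

Lemma mdist_le_diameter (R : realType) (X : metricType R) (A : set X) (x y : X) :
  A x -> A y -> ((mdist x y)%:E <= diameter A)%E.
Proof.
move=> Ax Ay; rewrite /diameter le_max; apply/orP; right.
by apply: ereal_sup_ubound; exists (x, y).
Qed.

(** A vanishing Hausdorff measure forces the infimum over countable covers at
    each scale to be finite, so that such covers exist. *)
Lemma finite_dimensional_countable_cover (R : realType) (X : metricType R)
    (e : R) : finite_dimensional X -> 0 < e ->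
  exists U : (set X)^nat,
    [set: X] `<=` \bigcup_i U i /\ forall i, (diameter (U i) <= e%:E)%E.
Proof.
move=> fdimX e0.
have [_ [s [s0 Hs0] <-] _] : exists2 x : \bar R,
    [set s%:E | s in [set s : R | 0 < s /\
      hausdorff_measure s [set: X] = 0%E]] x & (x < +oo)%E.
  exact: ereal_inf_lt fdimX.
have : (hausdorff_premeasure s e [set: X] < 1%:E)%E.
  apply: (@le_lt_trans _ _ 0%E); last by rewrite lte_fin.
  by rewrite -Hs0; apply: ereal_sup_ubound; exists e.
by move=> /ereal_inf_lt [_ [U UP _] _]; exists U.
Qed.

(** One point in each set of the k-th cover, for all k. The points are indexed
    by pairs (scale, member of the cover); [x0] stands in for the empty
    members. *)
Lemma finite_dimensional_separable (R : realType) (X : metricType R) (x0 : X) :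
  finite_dimensional X ->
  exists q : nat * nat -> X, forall x (e : R), 0 < e ->
    exists p, mdist (q p) x < e.
Proof.
move=> fdimX.
have /choice[U UP] : forall k : nat, exists U : (set X)^nat,
    [set: X] `<=` \bigcup_i U i /\
    forall i, (diameter (U i) <= (k.+1%:R^-1)%:E)%E.
  by move=> k; apply: finite_dimensional_countable_cover => //.
have /choice[q qP] : forall p : nat * nat, exists x,
    U p.1 p.2 !=set0 -> U p.1 p.2 x.
  move=> p; have [->|/set0P[x Ux]] := eqVneq (U p.1 p.2) set0.
    by exists x0 => -[].
  by exists x.
exists q => x e e0.
have [k] := ltr_add_invr e0; rewrite add0r => ke.
have [i _ Ukix] := (UP k).1 x I.
exists (k, i); apply: le_lt_trans ke; rewrite -lee_fin.
apply: le_trans ((UP k).2 i); apply: mdist_le_diameter => //.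
by apply: (qP (k, i)); exists x.
Qed.

Lemma measurable_mdist_lt (R : realType) (d : measure_display)
    (X : metricMeasurableType R d) (x : X) (r : R) :
  borel_measurable X -> measurable [set y : X | mdist x y < r].
Proof.
rewrite /borel_measurable => ->; apply: sub_sigma_algebra.
rewrite /= openE => y /= xyr; rewrite /interior.
apply/nbhs_ballP; exists (r - mdist x y) => /=; first by rewrite subr_gt0.
move=> z; rewrite ballEmdist/= ltrBrDl => xyz.
exact: le_lt_trans (metric_triangle _ _ _) xyz.
Qed.

Definition close_pairs (R : realType) (X : metricType R) (r : R) :
  set (X * X) := [set z | mdist z.1 z.2 < r].

(** When d(x, y) < r, any point q of a dense sequence that is close enough to x
    satisfies d(q, x) < t and d(q, y) < r - t for some t = 1/(m+1), and these
    two inequalities conversely imply d(x, y) < r. Thus the set is a countable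
    union of measurable rectangles. *)
Lemma measurable_close_pairs (R : realType) (d : measure_display)
    (X : metricMeasurableType R d) (r : R) :
  borel_measurable X -> finite_dimensional X ->
  measurable (close_pairs r : set (X * X)).
Proof.
move=> borelX fdimX.
have [X0|/set0P[x0 _]] := eqVneq [set: X] set0.
  rewrite (_ : close_pairs _ = set0)//; apply/seteqP; split => // -[x y] _.
  by have : [set: X] x by []; rewrite X0.
have [q qP] := finite_dimensional_separable x0 fdimX.
pose F (p : nat * nat * nat) : set (X * X) :=
  [set x | mdist (q p.1) x < p.2.+1%:R^-1] `*`
  [set y | mdist (q p.1) y < r - p.2.+1%:R^-1].
rewrite (_ : close_pairs r = \bigcup_p F p); last first.
  apply/seteqP; split => [[x y]/= xyr|[x y] [p _ []]/=].
    have [k] := ltr_add_invr xyr.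
    (* d(x, y) + 1/(k+1) < r, and half of this margin is a radius t that leaves
       room for replacing x by q on the second side. *)
    have k2 : (0 : R) < k.*2.+2%:R^-1 by rewrite invr_gt0.
    have k2E : k.*2.+2%:R^-1 *+ 2 = k.+1%:R^-1 :> R.
      by rewrite -doubleS -mul2n natrM; field; apply: lt0r_neq0.
    rewrite -k2E mulr2n /= => xyk.
    have [p px] := qP x _ k2.
    exists (p, k.*2.+1) => //; split => //=.
    apply: le_lt_trans (metric_triangle _ x _) _.
    rewrite ltrBrDr addrAC; apply: le_lt_trans xyk.
    by rewrite [leLHS]addrC lerD2l lerD2r ltW.
  move=> px py; rewrite /close_pairs/=.
  apply: le_lt_trans (metric_triangle _ (q p.1) _) _.
  by rewrite metric_sym; have := ltrD px py; rewrite addrCA subrr addr0.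
apply: countable_bigcupT_measurable => // p.
by apply: measurableX; apply: measurable_mdist_lt.
Qed.

(** * Invariance of the product measure *)

Lemma measure_preserving_iter (R : realType) (d : measure_display)
    (X : measurableType d) (mu : probability X R) (T : X -> X) (n : nat) :
  measure_preserving mu T -> measure_preserving mu (iter n T).
Proof.
move=> [mT muT]; elim: n => [|n [mTn muTn]].
  by split=> //; exact: measurable_id.
split=> [|A mA]; first exact: measurableT_comp.
rewrite -[RHS]muT// -[RHS]muTn//.
by rewrite -[T @^-1` A]setTI; exact: mT.
Qed.

(** The image of the product measure under f x g agrees with it on rectangles,
    and a measure is determined by its values there. *)
Lemma product_measure_preserving (R : realType) (d : measure_display)
    (X : measurableType d) (mu : probability X R) (f g : X -> X)
    (A : set (X * X)) :
  measure_preserving mu f -> measure_preserving mu g -> measurable A ->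
  measurable ((fun z => (f z.1, g z.2)) @^-1` A) /\
  (mu \x mu)%E ((fun z => (f z.1, g z.2)) @^-1` A) = (mu \x mu)%E A.
Proof.
move=> [mf muf] [mg mug] mA; set h := fun z => _.
have mh : measurable_fun [set: X * X] h.
  by apply: measurable_fun_pair; apply: measurableT_comp.
split; first by rewrite -[_ @^-1` _]setTI; exact: mh.
apply/esym.
rewrite (product_measure_unique
  (m' := pushforward (mu \x mu)%E h)) //.
move=> B C mB mC.
have mfB : measurable (f @^-1` B) by rewrite -[_ @^-1` _]setTI; exact: mf.
have mgC : measurable (g @^-1` C) by rewrite -[_ @^-1` _]setTI; exact: mg.
transitivity (mu (f @^-1` B) * mu (g @^-1` C))%E; last by rewrite muf// mug.
exact: product_measure1E.
Qed.

(** * The correlation integral *)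

Lemma close_pairs_correlation_integral (R : realType) (d : measure_display)
    (X : metricMeasurableType R d) (mu : probability X R) (r : R) :
  (mu \x mu)%E (close_pairs r) = (\int[mu]_x mu (ball x r))%E.
Proof.
rewrite /product_measure1; apply: eq_integral => x _ /=; congr (mu _).
by apply/seteqP; split => y; rewrite ballEmdist /xsection /= inE.
Qed.

(** As log r < 0, a lower bound c on log I(r) / log r is an upper bound r^c on
    I(r). The values 0 and +oo of the integral are covered: the former makes
    the bound trivial, and the latter would make the quotient -oo. *)
Lemma close_pairs_measure_le (R : realType) (d : measure_display)
    (X : metricMeasurableType R d) (mu : probability X R) (c : R) :
  (c%:E < lower_correlation_dim mu)%E ->
  \forall r \near 0^'+, ((mu \x mu)%E (close_pairs r) <= (r `^ c)%:E)%E.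
Proof.
rewrite /lower_correlation_dim limf_einfE => /ereal_sup_gt[_ [V nV <-] cV].
near=> r.
have r0 : 0 < r by near: r; exact: nbhs_right_gt.
have r1 : r < 1 by near: r; exact: nbhs_right_lt.
have lnr0 : ln r < 0 by rewrite -ln1 ltr_ln ?posrE.
have Vr : V r by near: r.
rewrite close_pairs_correlation_integral.
have : (c%:E <= lne (\int[mu]_x mu (ball x r)) / (ln r)%:E)%E.
  by apply: (le_trans (ltW cV)); apply: ereal_inf_lbound; exists r.
case: (\int[mu]_x mu (ball x r))%E => [y||]; rewrite ?leNye//.
- have [y0 _|y0] := leP y 0.
    by rewrite lee_fin (le_trans y0)// powR_ge0.
  rewrite lne_EFin// inver lt_eqF// -EFinM !lee_fin.
  rewrite ler_ndivlMr// => ycr.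
  by rewrite -ler_ln ?posrE ?powR_gt0// ln_powR.
- rewrite /= inver lt_eqF// lt0_mulye ?leeNy_eq//.
  by rewrite lte_fin invr_lt0.
Unshelve. all: by end_near.
Qed.

(** * Pairs of orbits that come close *)

Definition close_orbits (R : realType) (X : metricType R) (T : X -> X) (n : nat)
    (r : R) : set (X * X) :=
  \bigcup_(i < n) \bigcup_(j < n)
    (fun z => (iter i T z.1, iter j T z.2)) @^-1` close_pairs r.

(** For n = 0 the union is empty whereas the orbit distance is d(x, y), whence
    the hypothesis on n. *)
Lemma orbit_dist_ge (R : realType) (X : metricType R) (T : X -> X) (n : nat)
    (r : R) (z : X * X) : (0 < n)%N ->
  ~ close_orbits T n r z -> r <= orbit_dist T n z.1 z.2.
Proof.
move=> n0 zF.
have far (i j : 'I_n) : r <= mdist (iter i T z.1) (iter j T z.2).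
  rewrite leNgt; apply/negP => zij; apply: zF.
  exists (nat_of_ord i); first exact: ltn_ord.
  by exists (nat_of_ord j); first exact: ltn_ord.
have far0 := far (Ordinal n0) (Ordinal n0).
by apply: le_bigmin => // i _; exact: le_bigmin.
Qed.

Lemma orbit_dist_antitone (R : realType) (X : metricType R) (T : X -> X)
    (m n : nat) (x y : X) :
  (m <= n)%N -> orbit_dist T n x y <= orbit_dist T m x y.
Proof.
move=> mn; apply: (@le_trans _ _ (\big[Num.min/mdist x y]_(i < n)
    \big[Num.min/mdist x y]_(j < m) mdist (iter i T x) (iter j T y))).
  by apply: le_bigmin2 => i _;
    apply: (le_bigmin_ord xpredT (fun j => mdist (iter i T x) (iter j T y))).
exact: (le_bigmin_ord xpredT (fun i => \big[Num.min/mdist x y]_(j < m)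
  mdist (iter i T x) (iter j T y))).
Qed.

Section close_orbits_measure.
Context (R : realType) (d : measure_display) (X : metricMeasurableType R d)
  (mu : probability X R) (T : X -> X).
Hypotheses (borelX : borel_measurable X) (fdimX : finite_dimensional X)
  (muT : measure_preserving mu T).

Let shifted (r : R) (i j : nat) : set (X * X) :=
  (fun z => (iter i T z.1, iter j T z.2)) @^-1` close_pairs r.

Let shiftedE r i j : measurable (shifted r i j) /\
  (mu \x mu)%E (shifted r i j) = (mu \x mu)%E (close_pairs r).
Proof.
apply: product_measure_preserving; [exact: measure_preserving_iter..|].
exact: measurable_close_pairs.
Qed.

Let measurable_row n r i : measurable (\bigcup_(j < n) shifted r i j).
Proof. exact: (bigcup_measurable (fun j _ => (shiftedE r i j).1)). Qed.

Lemma measurable_close_orbits n r : measurable (close_orbits T n r).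
Proof.
exact: (bigcup_measurable (fun i _ => measurable_row n r i)).
Qed.

(** The union bound: each of the n^2 sets in the union has, by invariance, the
    mass of the pairs at distance less than r. *)
Lemma close_orbits_measure_le n r :
  ((mu \x mu)%E (close_orbits T n r) <=
   ((n ^ 2)%:R)%:E * (mu \x mu)%E (close_pairs r))%E.
Proof.
have mS i j : measurable (shifted r i j) by have [] := shiftedE r i j.
pose row i := \bigcup_(j < n) shifted r i j.
rewrite /close_orbits bigcup_mkord.
apply: (le_trans (Boole_inequality (mu \x mu)%E (A := row) _)).
  by move=> i _; exact: measurable_row.
apply: (@le_trans _ _ (\sum_(i < n) \sum_(j < n)
    (mu \x mu)%E (close_pairs r))%E).
  apply: lee_sum => i _.
  rewrite /row bigcup_mkord.
  apply: (le_trans (Boole_inequality (mu \x mu)%E (A := shifted r i) _)).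
    by move=> j _; exact: mS.
  by apply: lee_sum => j _; have [_ <-] := shiftedE r i j.
by rewrite !sumr_const !card_ord -mulrnA -mulnn mule_natl.
Qed.

End close_orbits_measure.

(** * From powers of two to all times *)

Lemma limf_esup_le_near (T : choiceType) (Y : filteredType T) (R : realType)
    (f : Y -> \bar R) (F : set_system Y) (l : \bar R) :
  (\forall t \near F, (f t <= l)%E) -> (limf_esup f F <= l)%E.
Proof.
move=> fl; apply: ge_ereal_inf.
exists (ereal_sup [set f t | t in [set t | (f t <= l)%E]]).
  by exists [set t | (f t <= l)%E].
by apply: ge_ereal_sup => _ [t /= ftl <-].
Qed.

(** If 2^k <= n < 2^(k+1), then m_n >= m_(2^(k+1)) >= 2^(- s (k+1)), so that
    - log m_n <= s log n + s log 2, and the last term is negligible against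
    log n. *)
Lemma limn_esup_orbit_dist_le (R : realType) (X : metricType R) (T : X -> X)
    (s : R) (x y : X) : 0 < s ->
  (\forall k \near \oo, (2 `^ (- s)) ^+ k <= orbit_dist T (2 ^ k) x y) ->
  (limn_esup (fun n : nat =>
     lne (orbit_dist T n x y)%:E / (- ln n%:R)%:E) <= s%:E)%E.
Proof.
move=> s0 [K _ dyadic]; apply/lee_addgt0Pr => e e0.
apply: limf_esup_le_near; near=> n.
have n2 : (1 < n)%N by near: n; exact: nbhs_infty_gt.
have nK : (2 ^ K <= n)%N by near: n; exact: nbhs_infty_ge.
(* This makes the error term s log 2 at most e log n. *)
have ne : expR (s * ln 2 / e) <= n%:R by near: n; exact: nbhs_infty_ger.
have n0 : (0 : R) < n%:R by rewrite ltr0n ltnW.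
have ln2_gt0 : 0 < ln 2 :> R by rewrite ln_gt0// ltr1n.
have lnn0 : 0 < ln n%:R :> R by rewrite ln_gt0// ltr1n.
have rho0 : 0 < 2 `^ (- s) :> R by rewrite powR_gt0.
set k := trunc_log 2 n.
have /andP[kn nk] : (2 ^ k <= n < 2 ^ k.+1)%N.
  by apply: trunc_log_bounds => //; exact: ltnW.
have mk : (2 `^ (- s)) ^+ k.+1 <= orbit_dist T n x y.
  apply: le_trans (orbit_dist_antitone _ _ _ (ltnW nk)).
  apply: dyadic => /=; apply: ltnW.
  by rewrite -(ltn_exp2l _ _ (ltnSn 1)) (leq_ltn_trans nK).
have m0 : 0 < orbit_dist T n x y by rewrite (lt_le_trans _ mk)// exprn_gt0.
rewrite lne_EFin// inver oppr_eq0 gt_eqF// -EFinM -EFinD lee_fin.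
rewrite ler_ndivrMr ?oppr_lt0//.
have lnm : - (s * ln 2) * k.+1%:R <= ln (orbit_dist T n x y).
  by rewrite mulr_natr -mulNr -ln_powR -lnXn// ler_ln ?posrE// exprn_gt0.
apply: le_trans lnm.
have kn' : ln 2 * k%:R <= ln n%:R :> R.
  rewrite mulr_natr -lnXn// ler_ln ?posrE ?exprn_gt0//.
  by rewrite -natrX ler_nat.
have sen : s * ln 2 <= e * ln n%:R.
  by rewrite [leRHS]mulrC -ler_pdivrMr// -[leLHS]expRK ler_ln ?posrE ?expR_gt0.
rewrite -natr1; nra.
Unshelve. all: by end_near.
Qed.

(** * Borel-Cantelli *)

Lemma nneseries_geometric_lty (R : realType) (u : (\bar R)^nat) (q : R) :
  0 < q -> q < 1 -> (forall k, (0 <= u k <= (q ^+ k)%:E)%E) ->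
  (\sum_(0 <= k <oo) u k < +oo)%E.
Proof.
move=> q0 q1 uq; apply: (@le_lt_trans _ _ (1 / (1 - q))%:E); last exact: ltry.
apply: lime_le.
  by apply: is_cvg_nneseries => k _ _; have /andP[] := uq k.
apply: nearW => n.
apply: (@le_trans _ _ (\sum_(0 <= k < n) (q ^+ k)%:E)%E).
  by apply: lee_sum => k _; have /andP[] := uq k.
rewrite sumEFin lee_fin.
rewrite (_ : \sum_(_ <= _ < _) _ = series (geometric 1 q) n); last first.
  by apply: eq_bigr => k _ /=; rewrite mul1r.
by apply: geometric_le_lim => //; rewrite ger0_norm ?ltW.
Qed.

(** The condition c s > 2 is what makes the masses (2^k)^2 (2^(- s k))^c of the
    exceptional sets a convergent geometric series; by Borel-Cantelli almost
    every pair lies in finitely many of these sets. *)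
Lemma ae_limn_esup_orbit_dist_le (R : realType) (d : measure_display)
    (X : metricMeasurableType R d) (mu : probability X R) (T : X -> X)
    (borelX : borel_measurable X) (fdimX : finite_dimensional X)
    (muT : measure_preserving mu T) (c s : R) :
  0 < s -> 2 < c * s -> (c%:E < lower_correlation_dim mu)%E ->
  {ae (mu \x mu)%E, forall z : X * X,
    (limn_esup (fun n : nat =>
       lne (orbit_dist T n z.1 z.2)%:E / (- ln n%:R)%:E) <= s%:E)%E}.
Proof.
move=> s0 cs2 cC.
pose rho : R := 2 `^ (- s).
pose q : R := 2 `^ (2 - c * s).
have rho0 : 0 < rho by rewrite powR_gt0.
have rho1 : rho < 1.
  rewrite /rho -ltr_ln ?posrE ?powR_gt0// ln1 ln_powR.
  by rewrite pmulr_llt0 ?ln_gt0 ?ltr1n// oppr_lt0.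
have q0 : 0 < q by rewrite powR_gt0.
have q1 : q < 1.
  rewrite /q -ltr_ln ?posrE ?powR_gt0// ln1 ln_powR.
  by rewrite pmulr_llt0 ?ln_gt0 ?ltr1n// subr_lt0.
have qE k : (((2 ^ k) ^ 2)%:R * (rho ^+ k) `^ c : R) = q ^+ k.
  rewrite -[rho ^+ k]powR_mulrn ?ltW// /rho -!powRrM.
  rewrite -[q ^+ k]powR_mulrn ?ltW// /q -powRrM -expnM natrX.
  rewrite -powR_mulrn// -powRD ?pnatr_eq0 ?implybT//.
  by congr (_ `^ _); rewrite natrM; ring.
(* The bound on the correlation integral holds for small radii only, so the
   exceptional sets are taken from the index N on. *)
have [N _ smallN] : \forall k \near \oo,
    ((mu \x mu)%E (close_pairs (rho ^+ k)) <= ((rho ^+ k) `^ c)%:E)%E.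
  have [e /= e0 eP] := close_pairs_measure_le cC.
  have := @cvg_expr R rho; rewrite ger0_norm ?ltW// => /(_ rho1).
  move=> /cvgrPdist_lt/(_ e e0); apply: filterS => k ke.
  by apply: eP => //=; rewrite exprn_gt0.
pose F k := close_orbits T (2 ^ (k + N)) (rho ^+ (k + N)).
have mF k : measurable (F k).
  exact: (measurable_close_orbits borelX fdimX muT).
have F0 : (mu \x mu)%E (lim_sup_set F) = 0%E.
  apply: lim_sup_set_cvg0 => //.
  apply: (nneseries_geometric_lty q0 q1) => k; rewrite measure_ge0 /=.
  apply: (le_trans (close_orbits_measure_le borelX fdimX muT _ _)).
  apply: (@le_trans _ _ (q ^+ (k + N))%:E).
    rewrite -qE EFinM; apply: lee_wpmul2l; first by rewrite lee_fin.
    by apply: smallN; rewrite /= leq_addl.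
  by rewrite lee_fin ler_wiXn2l ?ltW// leq_addr.
exists (lim_sup_set F); split => //.
  by apply: bigcap_measurable => // n _; exact: bigcup_measurable.
move=> z; apply: contra_notP => /= zF.
apply: limn_esup_orbit_dist_le => //.
have [K KF] : exists K, forall k, (K <= k)%N -> ~ F k z.
  apply: contrapT => /forallNP nK; apply: zF => K _.
  have /existsNP[k /not_implyP[Kk /contrapT Fk]] := nK K.
  by exists k.
exists (K + N)%N => // k /= KNk.
have kE : k = (k - N + N)%N by rewrite subnK// (leq_trans _ KNk)// leq_addl.
rewrite kE; apply: orbit_dist_ge; first by rewrite expn_gt0.
by apply: KF; rewrite leq_subRL ?(leq_trans _ KNk) ?leq_addl// addnC.
Qed.

Theorem theorem1 (R : realType) (d : measure_display)
    (X : metricMeasurableType R d) (mu : probability X R) (T : X -> X)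
    (borelX : borel_measurable X)
    (fdimX : finite_dimensional X)
    (muT : measure_preserving mu T)
    (Cmu_gt0 : (0 < lower_correlation_dim mu)%E) :
  {ae (mu \x mu)%E, forall z : X * X,
    (limn_esup (fun n : nat =>
       lne (orbit_dist T n z.1 z.2)%:E / (- ln n%:R)%:E)
     <= 2%:E / lower_correlation_dim mu)%E}.
Proof.
(* L is the real number 2 / C, equal to 0 when C = +oo. Each s > L leaves room
   for a c with 2 / s < c < C. *)
have [L [L0 LE Lc]] : exists L : R, [/\ 0 <= L,
    (2%:E / lower_correlation_dim mu = L%:E)%E &
    forall s, L < s ->
      exists2 c, 2 < c * s & (c%:E < lower_correlation_dim mu)%E].
  case: (lower_correlation_dim mu) Cmu_gt0 => [C||]//.
  - rewrite lte_fin => C0; exists (2 / C); split.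
    + by rewrite divr_ge0// ltW.
    + by rewrite inver gt_eqF.
    + move=> s; rewrite ltr_pdivrMr// => Cs.
      have s0 : 0 < s by rewrite -(pmulr_lgt0 _ C0) (lt_trans _ Cs).
      exists ((C + 2 / s) / 2).
        by rewrite mulrAC mulrDl divfK ?gt_eqF//; lra.
      have : 2 / s < C by rewrite ltr_pdivrMr// mulrC.
      by rewrite lte_fin; lra.
  - move=> _; exists 0; split=> //; first by rewrite invey mule0.
    move=> s s0; exists (3 / s); last exact: ltry.
    by rewrite divfK ?gt_eqF//; lra.
rewrite LE.
have /ae_foralln : forall j : nat, {ae (mu \x mu)%E, forall z : X * X,
    (limn_esup (fun n : nat =>
       lne (orbit_dist T n z.1 z.2)%:E / (- ln n%:R)%:E)
     <= (L + j.+1%:R^-1)%:E)%E}.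
  move=> j; have Lj : L < L + j.+1%:R^-1 by rewrite ltrDl invr_gt0.
  have [c cs cC] := Lc _ Lj.
  exact: ae_limn_esup_orbit_dist_le (le_lt_trans L0 Lj) cs cC.
apply: filterS => z zL; apply/lee_addgt0Pr => e e0.
have [j] := ltr_add_invr e0; rewrite add0r => je.
by apply: le_trans (zL j) _; rewrite -EFinD lee_fin lerD2l ltW.
Qed.
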